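(* Let $X$ be a non-empty set, $A$ a non-empty subset of $X$, and $\alpha$ an equivalence relation on $X$ with equivalence classes $\{A_i:i\in I\}$. Then (i) $\operatorname{rank}(\mathbb E(\mathcal T_X(A)))=\operatorname{idrank}(\mathbb E(\mathcal T_X(A)))$, and this equals $1$ if $|A|=1$; $2^{|X|}$ if $X$ is infinite and $|A|\ge2$; $2+2^{|X|-2}$ if $|A|=2$ and $X$ is finite; and $\binom{|A|}{2}+|A|^{|X|-|A|}$ otherwise; (ii) $\operatorname{rank}(\mathbb E(\mathcal T_X(\alpha)))=\operatorname{idrank}(\mathbb E(\mathcal T_X(\alpha)))$, and this equals $|X|$ if $\|\alpha\|=1$; $2^{\|\alpha\|}\prod_{i\in I}|A_i|$ if $\|\alpha\|$ is infinite; $2+\prod_{i\in I}|A_i|$ if $\|\alpha\|=2$ and $X$ is finite; and $\binom{\|\alpha\|}{2}+\prod_{i\in I}|A_i|$ otherwise.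
   Context: $\mathcal T_X(A)=\{f:X\to X\mid\operatorname{im}(f)\subseteq A\}$ and $\mathcal T_X(\alpha)=\{f:X\to X\mid\ker(f)\supseteq\alpha\}$, semigroups under composition, $\ker(f)=\{(x,y):xf=yf\}$. $\mathbb E(T)$ is the subsemigroup generated by the idempotents of $T$. $\operatorname{rank}(T)$ is the minimum size of a generating set; $\operatorname{idrank}(T)$ is the minimum size of a generating set consisting of idempotents. $\|\alpha\|=|I|$ is the number of $\alpha$-classes. *)

(* Defs.v *)
From mathcomp Require Import all_boot.
Set Implicit Arguments. Unset Strict Implicit. Unset Printing Implicit Defensive.

Definition card_le (U V : Type) (P : U -> Prop) (Q : V -> Prop) : Prop :=
  exists f : U -> V, (forall x, P x -> Q (f x)) /\
    (forall x y, P x -> P y -> f x = f y -> x = y).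

Definition card_eq (U V : Type) (P : U -> Prop) (Q : V -> Prop) : Prop :=
  exists f : U -> V, (forall x, P x -> Q (f x)) /\
    (forall x y, P x -> P y -> f x = f y -> x = y) /\
    (forall y, Q y -> exists2 x, P x & f x = y).

Definition has_card (U : Type) (P : U -> Prop) (n : nat) : Prop :=
  card_eq P (fun k : nat => k < n).

Definition finite_set (U : Type) (P : U -> Prop) : Prop := exists n, has_card P n.

Definition allX (X : Type) : X -> Prop := fun _ => True.
Arguments allX X _ : clear implicits.

(* composition "f then g" (the paper writes maps on the right: x(fg) = (xf)g) *)
Definition comp_tr (X : Type) (f g : X -> X) : X -> X := fun x => g (f x).

Definition idempotent_tr (X : Type) (f : X -> X) : Prop := comp_tr f f = f.

Inductive sgen (X : Type) (G : (X -> X) -> Prop) : (X -> X) -> Prop :=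
| sgen_base f : G f -> sgen G f
| sgen_comp f g : sgen G f -> sgen G g -> sgen G (comp_tr f g).

Definition TXA (X : Type) (A : X -> Prop) : (X -> X) -> Prop :=
  fun f => forall x, A (f x).

Definition TXalpha (X : Type) (alpha : X -> X -> Prop) : (X -> X) -> Prop :=
  fun f => forall x y, alpha x y -> f x = f y.

Definition Eid (X : Type) (T : (X -> X) -> Prop) : (X -> X) -> Prop :=
  sgen (fun f => T f /\ idempotent_tr f).

Definition generating_set (X : Type) (S G : (X -> X) -> Prop) : Prop :=
  (forall f, G f -> S f) /\ (forall f, S f -> sgen G f).

Definition rank_is (X : Type) (S : (X -> X) -> Prop) (K : Type) (k : K -> Prop) : Prop :=
  (exists G, generating_set S G /\ card_eq G k) /\
  (forall G, generating_set S G -> card_le k G).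

Definition idrank_is (X : Type) (S : (X -> X) -> Prop) (K : Type) (k : K -> Prop) : Prop :=
  (exists G, generating_set S G /\ (forall f, G f -> idempotent_tr f) /\ card_eq G k) /\
  (forall G, generating_set S G -> (forall f, G f -> idempotent_tr f) -> card_le k G).

Definition rank_idrank_is (X : Type) (S : (X -> X) -> Prop) (K : Type) (k : K -> Prop) : Prop :=
  rank_is S k /\ idrank_is S k.

Definition is_equivalence {X : Type} (alpha : X -> X -> Prop) : Prop :=
  (forall x, alpha x x) /\ (forall x y, alpha x y -> alpha y x) /\
  (forall x y z, alpha x y -> alpha y z -> alpha x z).

Definition classes (X : Type) (alpha : X -> X -> Prop) : (X -> Prop) -> Prop :=
  fun C => exists x, C = alpha x.

(* the Cartesian product prod_{i in I} A_i, encoded as the choice functions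
   g : X -> X constant on classes with g x in the class of x *)
Definition class_product (X : Type) (alpha : X -> X -> Prop) : (X -> X) -> Prop :=
  fun g => (forall x, alpha x (g x)) /\ (forall x y, alpha x y -> g x = g y).

(* 2^{||alpha||}, encoded as maps X -> bool constant on classes *)
Definition class_powerset (X : Type) (alpha : X -> X -> Prop) : (X -> bool) -> Prop :=
  fun h => forall x y, alpha x y -> h x = h y.

Definition nat_plus (V : Type) (n : nat) (P : V -> Prop) : (nat + V)%type -> Prop :=
  fun s => match s with inl k => k < n | inr v => P v end.

Definition cprod_set (U V : Type) (P : U -> Prop) (Q : V -> Prop) : (U * V)%type -> Prop :=
  fun p => P p.1 /\ Q p.2.

(* Main.v *)
(* In the infinite cases the idempotents already number K, the claimed cardinal,
   and K is uncountable, while a set of size smaller than K generates fewer than K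
   maps; this rests on |L * L| = |L| for infinite L.

   In the finite cases, restricting to A, or passing to the classes of alpha,
   gives a morphism onto the idempotent-generated part of the full transformation
   monoid T_k. Its fibre over the identity (the retractions onto A, respectively
   the choice functions) is a left- or right-zero band; since an injective product
   of idempotents is the identity, none of its elements is a product of others, so
   it lies in every generating set. What remains is T_k minus its units: following
   Howie, for k >= 3 each pair {i, j} must occur as the kernel of a generator of
   rank k - 1, and the binom(k, 2) arcs [i |-> j] of a strongly connected
   tournament suffice. For k = 2 both constants are needed instead, which is
   invisible when the fibre is infinite. *)
Require Import Defs.
From mathcomp Require Import all_boot.
From mathcomp Require Import boolp classical_sets.
From mathcomp Require functions cardinality.
Set Implicit Arguments. Unset Strict Implicit. Unset Printing Implicit Defensive.

(** * Infinite cardinals *)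

Lemma card_le_refl (U : Type) (P : U -> Prop) : card_le P P.
Proof. by exists id. Qed.

Lemma card_le_sub (U : Type) (P Q : U -> Prop) : (forall x, P x -> Q x) -> card_le P Q.
Proof. by move=> PQ; exists id. Qed.

Lemma card_le_trans (U V W : Type) (P : U -> Prop) (Q : V -> Prop) (R : W -> Prop) :
  card_le P Q -> card_le Q R -> card_le P R.
Proof.
move=> [f [fP fi]] [g [gP gi]]; exists (g \o f); split=> [x Px|x y Px Py /= e].
  by apply/gP/fP.
by apply: fi => //; apply: gi => //; apply: fP.
Qed.

Lemma card_eq_le (U V : Type) (P : U -> Prop) (Q : V -> Prop) :
  card_eq P Q -> card_le P Q.
Proof. by move=> [f [fP [fi _]]]; exists f. Qed.

Lemma card_eq_trans (U V W : Type) (P : U -> Prop) (Q : V -> Prop) (R : W -> Prop) :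
  card_eq P Q -> card_eq Q R -> card_eq P R.
Proof.
move=> [f [fP [fi fs]]] [g [gP [gi gs]]]; exists (g \o f); split=> [x Px|].
  by apply/gP/fP.
split=> [x y Px Py /= e|z /gs [y /fs [x Px <-] <-]]; last by exists x.
by apply: fi => //; apply: gi => //; apply: fP.
Qed.

Lemma card_eq_sym (U V : Type) (u0 : U) (P : U -> Prop) (Q : V -> Prop) :
  card_eq P Q -> card_eq Q P.
Proof.
move=> [f [fP [fi fs]]].
have /choice[g gP] y : exists x, Q y -> P x /\ f x = y.
  by have [/fs[x Px fx]|nQ] := pselect (Q y); [exists x|exists u0].
exists g; split=> [y /gP[]//|]; split=> [y z /gP[_ ey] /gP[_ ez] e|x Px].
  by rewrite -ey -ez e.
have [Pg fg] := gP _ (fP _ Px).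
by exists (f x); [exact: fP|exact: fi].
Qed.

Lemma card_le_mathcomp (U V : Type) (P : U -> Prop) (Q : V -> Prop) :
  card_le P Q -> cardinality.card_le P Q.
Proof.
move=> [f [fP fi]].
have /cardinality.injfunPex[g] : exists2 f : U -> V,
    functions.set_fun P Q f & functions.set_inj P f.
  exists f; first exact: fP.
  by move=> x y /set_mem Px /set_mem Py; exact: fi.
exact: cardinality.inj_card_le.
Qed.

Lemma card_eq_mathcomp (U V : Type) (v0 : V) (P : U -> Prop) (Q : V -> Prop) :
  cardinality.card_eq P Q -> card_eq P Q.
Proof.
elim/Ppointed : V => V in v0 Q *; first by case: (no v0).
move=> /cardinality.card_set_bijP[f [fP fi fs]]; exists f.
split; first exact: fP.
split=> [x y Px Py|y /fs[x Px <-]]; last by exists x.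
by apply: fi; exact/mem_set.
Qed.

Lemma card_le_anti (U V : Type) (v0 : V) (P : U -> Prop) (Q : V -> Prop) :
  card_le P Q -> card_le Q P -> card_eq P Q.
Proof.
move=> PQ QP; apply: card_eq_mathcomp => //.
by apply: cardinality.Cantor_Bernstein; exact: card_le_mathcomp.
Qed.

Lemma card_le_nat_infinite (U : Type) (P : U -> Prop) :
  ~ finite_set P -> card_le (allX nat) P.
Proof.
move=> nfin.
have [u0 _] : exists u : U, True.
  apply: contrapT => nU; apply: nfin; exists 0; exists (fun=> 0).
  by split=> [x|]; [|split=> [x|y //]]; case: nU; exists x.
have : cardinality.card_le [set: nat] P.
  apply/cardinality.infiniteP => -[n] Pn; apply: nfin.
  by exists n; exact: (card_eq_mathcomp 0 Pn).
elim/Ppointed : U => U in P nfin u0 *; first by case: (no u0).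
move=> /cardinality.pcard_leP/cardinality.injfunPex[f fP fi]; exists f.
split=> [x _|x y _ _]; first exact: fP.
by apply: fi; exact: mem_set.
Qed.


(** * Comparability of cardinals and squares of infinite cardinals *)

Section Zorn_cardinals.
Local Open Scope classical_set_scope.

(** Zorn's lemma gives a maximal graph of a partial injection from [P] to [Q]. It is defined on all
    of [P] or reaches all of [Q], since otherwise a pair of missed points could be added. *)
Lemma card_le_total (U V : Type) (u0 : U) (v0 : V) (P : U -> Prop) (Q : V -> Prop) :
  card_le P Q \/ card_le Q P.
Proof.
pose good (R : set (U * V)) := [/\ forall x y, R (x, y) -> P x /\ Q y,
  forall x y y', R (x, y) -> R (x, y') -> y = y' &
  forall x x' y, R (x, y) -> R (x', y) -> x = x'].
have [F Fgood Ftot|R [[RPQ Rf Ri] Rmax]] := @Zorn_bigcup _ good.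
  have common p q : (\bigcup_(X in F) X) p -> (\bigcup_(X in F) X) q ->
      exists X, [/\ F X, X p & X q].
    move=> [X FX Xp] [Y FY Yq].
    by have [XY|YX] := Ftot _ _ FX FY; [exists Y|exists X]; split=> //;
      [exact: XY|exact: YX].
  split=> [x y [X FX Xxy]|x y y' h h'|x x' y h h'].
  - by have [+ _ _] := Fgood _ FX; apply.
  - have [X [FX X1 X2]] := common _ _ h h'.
    by have [_ + _] := Fgood _ FX => /(_ _ _ _ X1 X2).
  - have [X [FX X1 X2]] := common _ _ h h'.
    by have [_ _ +] := Fgood _ FX => /(_ _ _ _ X1 X2).
have [Ptot|/existsNP[x /not_implyP[Px /forallNP nx]]] :=
  pselect (forall x, P x -> exists y, R (x, y)).
  left; have /choice[f fP] x : exists y, P x -> R (x, y).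
    by have [/Ptot[y Ry]|nP] := pselect (P x); [exists y|exists v0].
  exists f; split=> [x /fP /RPQ[]//|x y /fP Rx /fP Ry e].
  by rewrite e in Rx; exact: (Ri _ _ _ Rx Ry).
have [Qtot|/existsNP[y /not_implyP[Qy /forallNP ny]]] :=
  pselect (forall y, Q y -> exists x, R (x, y)).
  right; have /choice[f fP] v : exists u, Q v -> R (u, v).
    by have [/Qtot[u Ru]|nP] := pselect (Q v); [exists u|exists u0].
  exists f; split=> [u /fP /RPQ[]//|u v /fP Ry /fP Rz e].
  by rewrite e in Ry; exact: (Rf _ _ _ Ry Rz).
exfalso; apply: (Rmax (fun p => R p \/ p = (x, y))).
  split; first by move=> p Rp; left.
  by move=> /(_ (x, y) (or_intror erefl)) /nx.
split=> [u v [/RPQ//|[-> ->]//]|u v w|u v w].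
- move=> [Ru|[eu ev]] [Ru'|[eu' ev']]; subst => //; first exact: Rf Ru Ru'.
    by case: (nx v).
  by case: (nx w).
- move=> [Ru|[eu ev]] [Ru'|[eu' ev']]; subst => //; first exact: Ri Ru Ru'.
    by case: (ny u).
  by case: (ny v).
Qed.

(** Hessenberg's theorem, by Zorn's lemma on graphs of injections from the square of [D F] to [D F],
    where [D F] is read off the diagonal. For a maximal graph, either the complement of [D F] embeds
    in [D F], and then so does all of [T], or [D F] embeds in its complement and the graph can be
    extended. *)
Lemma card_le_square (T : Type) : card_le (allX nat) (allX T) ->
  exists p : T -> T -> T, forall x y x' y', p x y = p x' y' -> x = x' /\ y = y'.
Proof.
move=> [io [_ ioI]]; have {}ioI : injective io by move=> m n; exact: ioI.
pose D (F : set (T * T * T)) x := exists z, F (x, x, z).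
pose good (F : set (T * T * T)) := [/\ forall x y z, F (x, y, z) -> [/\ D F x, D F y & D F z],
  forall x y, D F x -> D F y -> exists z, F (x, y, z),
  forall x y z z', F (x, y, z) -> F (x, y, z') -> z = z' &
  forall x y x' y' z, F (x, y, z) -> F (x', y', z) -> x = x' /\ y = y'].
(* A maximal graph is only known to have an infinite domain if it contains a
   seed [F0] with this property. *)
pose F0 : set (T * T * T) := fun q => exists m n,
  q = (io m, io n, io (pickle (m, n))).
have F0good : good F0.
  have D0 m : D F0 (io m) by exists (io (pickle (m, m))), m, m.
  split.
  - by move=> x y z [m [n [-> -> ->]]]; split; exact: D0.
  - move=> x y [z [m [? [-> _ _]]]] [z' [n [? [-> _ _]]]].
    by exists (io (pickle (m, n))), m, n.
  - by move=> x y z z' [m [n [-> -> ->]]] [m' [n' [/ioI <- /ioI <- ->]]].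
  - move=> x y x' y' z [m [n [-> -> ->]]] [m' [n' [-> -> /ioI]]].
    by move=> /(pcan_inj pickleK)[-> ->].
have [S Sgood Stot|A [Agood Amax]] := @Zorn_bigcup _ (fun F => good (F0 `|` F)).
  have [[X1 SX1]|S0] := pselect (exists X, S X); last first.
    suff -> : F0 `|` \bigcup_(X in S) X = F0 by [].
    rewrite bigcup0 ?setU0 // => X SX; case: S0; by exists X.
  have up X q : S X -> (F0 `|` X) q -> (F0 `|` \bigcup_(X in S) X) q.
    by move=> SX [F0q|Xq]; [left|right; exists X].
  have upD X x : S X -> D (F0 `|` X) x -> D (F0 `|` \bigcup_(X in S) X) x.
    by move=> SX [z Xz]; exists z; exact: up Xz.
  have in1 q : (F0 `|` \bigcup_(X in S) X) q -> exists2 X, S X & (F0 `|` X) q.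
    by move=> [F0q|[X SX Xq]]; [exists X1 => //; left|exists X => //; right].
  have common p q : (F0 `|` \bigcup_(X in S) X) p -> (F0 `|` \bigcup_(X in S) X) q ->
      exists X, [/\ S X, (F0 `|` X) p & (F0 `|` X) q].
    move=> /in1[X SX Xp] /in1[Y SY Yq].
    have [XY|YX] := Stot _ _ SX SY; [exists Y|exists X]; split=> //.
      by case: Xp => [|/XY]; [left|right].
    by case: Yq => [|/YX]; [left|right].
  split.
  - move=> x y z /in1[X SX Xq]; have [+ _ _ _] := Sgood _ SX.
    by move=> /(_ _ _ _ Xq)[dx dy dz]; split; exact: upD SX _.
  - move=> x y [z Xz] [z' Xz']; have [X [SX X1' X2']] := common _ _ Xz Xz'.
    have [_ + _ _] := Sgood _ SX => /(_ x y)[||w Xw]; first by exists z.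
      by exists z'.
    by exists w; exact: up Xw.
  - move=> x y z z' h h'; have [X [SX X1' X2']] := common _ _ h h'.
    by have [_ _ + _] := Sgood _ SX => /(_ _ _ _ _ X1' X2').
  - move=> x y x' y' z h h'; have [X [SX X1' X2']] := common _ _ h h'.
    by have [_ _ _ +] := Sgood _ SX => /(_ _ _ _ _ _ X1' X2').
(* Maximality in usable form: no good graph properly contains the seed together with [A]. Only this
   union, renamed [F], is kept below. *)
have AF (B : set (T * T * T)) : good B -> (forall q, (F0 `|` A) q -> B q) ->
    forall q, B q -> (F0 `|` A) q.
  move=> Bgood AB q Bq; apply: contrapT => nq.
  apply: (Amax (A `|` B)).
    split; first by move=> x; left.
    by move=> /(_ q (or_intror Bq)) Aq; apply: nq; right.
  suff -> : F0 `|` (A `|` B) = B by [].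
  apply/seteqP; split=> x; last by right; right.
  by move=> [F0x|[Ax|//]]; apply: AB; [left|right].
move: (F0 `|` A) (fun q h => or_introl h : (F0 `|` A) q) Agood AF.
move=> {Amax A} F F0F [Fd Ft Ff Fi] Fmax.
have D0 m : D F (io m) by exists (io (pickle (m, m))); apply: F0F; exists m, m.
have /choice[f fP] (q : T * T) : exists z, D F q.1 -> D F q.2 -> F (q.1, q.2, z).
  have [[dx dy]|nd] := pselect (D F q.1 /\ D F q.2).
    by have [z Fz] := Ft _ _ dx dy; exists z.
  by exists (io 0) => dx dy; case: nd.
have fF x y : D F x -> D F y -> F (x, y, f (x, y)) by exact: (fP (x, y)).
have fD x y : D F x -> D F y -> D F (f (x, y)).
  by move=> dx dy; have [] := Fd _ _ _ (fF _ _ dx dy).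
have fI x y x' y' : D F x -> D F y -> D F x' -> D F y' ->
    f (x, y) = f (x', y') -> x = x' /\ y = y'.
  move=> dx dy dx' dy' e; move: (fF _ _ dx dy); rewrite e => h.
  exact: Fi h (fF _ _ dx' dy').
have [[g [gD gI]]|[g [gD gI]]] :=
    card_le_total (io 0) (io 0) (fun x => ~ D F x) (D F).
  (* [e] embeds [T] in [D F]; the tags [io 0] and [io 1] keep apart the points inside and outside
     [D F]. *)
  pose e x := if pselect (D F x) then f (x, io 0) else f (g x, io 1).
  have eD x : D F (e x) by rewrite /e; case: pselect => dx; apply: fD => //; exact: gD.
  have eI : injective e.
    have io01 : io 0 <> io 1 by move=> /ioI.
    move=> x y; rewrite /e; case: pselect => dx; case: pselect => dy.
    - by move=> /fI[].
    - by move=> /fI[]; do ?[by []|exact: gD] => _ /io01.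
    - by move=> /fI[]; do ?[by []|exact: gD] => _ /esym /io01.
    - by move=> /fI[]; do ?[by []|exact: gD] => /gI ->.
  by exists (fun x y => f (e x, e y)) => x y x' y' /fI[] // /eI -> /eI ->.
(* Otherwise a disjoint copy [g] of the domain [D F] fits in its complement, and
   the three new blocks of the square of the union are coded, with tags, there. *)
pose t i u v := g (f (f (u, v), io i)).
have tD i u v : D F u -> D F v -> ~ D F (t i u v).
  by move=> du dv; apply/gD/fD; [exact: fD|exact: D0].
have tI i u v i' u' v' : D F u -> D F v -> D F u' -> D F v' ->
    t i u v = t i' u' v' -> [/\ i = i', u = u' & v = v'].
  move=> du dv du' dv' /gI e.
  have /fI[] := e (fD _ _ (fD _ _ du dv) (D0 i)) (fD _ _ (fD _ _ du' dv') (D0 i')).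
  - exact: fD.
  - exact: D0.
  - exact: fD.
  - exact: D0.
  - by move=> euv /ioI ->; have [] := fI _ _ _ _ du dv du' dv' euv.
exfalso.
pose B : set (T * T * T) := fun q => F q \/ exists u v, D F u /\ D F v /\
  (q = (u, g v, t 0 u v) \/ q = (g u, v, t 1 u v) \/ q = (g u, g v, t 2 u v)).
have FB q : F q -> B q by left.
have DB x : D F x -> D B x by move=> [z Fz]; exists z; left.
have DgB x : D F x -> D B (g x).
  by move=> dx; exists (t 2 x x); right; exists x, x; do 2 split=> //; right; right.
have BD x : D B x -> D F x \/ exists2 u, D F u & x = g u.
  move=> [z [Fz|[u [v [du [dv h]]]]]]; first by left; exists z.
  by case: h => [[-> _ _]|[[_ -> _]|[-> _ _]]]; [left|left|right; exists u].
(* By maximality a good [B] lies inside [F], which would put [g (io 0)] in [D F]. *)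
have Bgood : good B; last first.
  have : D F (g (io 0)).
    have [z Bz] : D B (g (io 0)) by exact: DgB.
    by exists z; exact: Fmax Bz.
  exact: gD.
have tB i u v : D F u -> D F v -> D B (t i u v).
  by move=> du dv; apply: DgB; apply: (fD); [exact: fD|exact: D0].
split.
- move=> x y z [/Fd[dx dy dz]|[u [v [du [dv]]]]]; first by split; exact: DB.
  by move=> [[-> -> ->]|[[-> -> ->]|[-> -> ->]]]; split; do ?[exact: tB|exact: DB|exact: DgB].
- move=> x y /BD[dx|[u du ->]] /BD[dy|[v dv ->]].
  + by have [z Fz] := Ft _ _ dx dy; exists z; left.
  + by exists (t 0 x v); right; exists x, v; do 2 split=> //; left.
  + by exists (t 1 u y); right; exists u, y; do 2 split=> //; right; left.
  + by exists (t 2 u v); right; exists u, v; do 2 split=> //; right; right.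
- move=> x y z z' [Fz|[u [v [du [dv h]]]]] [Fz'|[u' [v' [du' [dv' h']]]]].
  + exact: Ff Fz Fz'.
  + have [dx dy dz] := Fd _ _ _ Fz; case: h' => [[ex ey ez]|[[ex ey ez]|[ex ey ez]]];
      subst; by [case: (gD _ _ dx)|case: (gD _ _ dy)].
  + have [dx dy dz] := Fd _ _ _ Fz'; case: h => [[ex ey ez]|[[ex ey ez]|[ex ey ez]]];
      subst; by [case: (gD _ _ dx)|case: (gD _ _ dy)].
  + case: h => [[ex ey ez]|[[ex ey ez]|[ex ey ez]]];
      case: h' => [[ex' ey' ez']|[[ex' ey' ez']|[ex' ey' ez']]]; subst;
      do ?by [case: (gD _ _ du)|case: (gD _ _ dv)|case: (gD _ _ du')|case: (gD _ _ dv')].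
    * by rewrite (gI _ _ dv dv' ey').
    * by rewrite (gI _ _ du du' ex').
    * by rewrite (gI _ _ dv dv' ey') (gI _ _ du du' ex').
- move=> x y x' y' z [Fz|[u [v [du [dv h]]]]] [Fz'|[u' [v' [du' [dv' h']]]]].
  + exact: Fi Fz Fz'.
  + have [dx dy dz] := Fd _ _ _ Fz; case: h' => [[ex ey ez]|[[ex ey ez]|[ex ey ez]]];
      subst; by case: (tD _ _ _ du' dv' dz).
  + have [dx dy dz] := Fd _ _ _ Fz'; case: h => [[ex ey ez]|[[ex ey ez]|[ex ey ez]]];
      subst; by case: (tD _ _ _ du dv dz).
  + by case: h => [[-> -> ez]|[[-> -> ez]|[-> -> ez]]];
      case: h' => [[-> -> ez']|[[-> -> ez']|[-> -> ez']]];
      have [] // := tI _ _ _ _ _ _ du dv du' dv' (etrans (esym ez) ez');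
      move=> _ -> ->.
Qed.

End Zorn_cardinals.

(** A word is coded by iterated pairing. Its length is coded as well, because [io 0], where the
    pairing starts, may itself be the code of a pair. *)
Lemma card_le_seq (T : Type) : card_le (allX nat) (allX T) ->
  exists enc : seq T -> T, injective enc.
Proof.
move=> infT; have [io [_ ioI]] := infT; have [p pI] := card_le_square infT.
exists (fun w => p (io (size w)) (foldr p (io 0) w)) => v w /pI[/ioI esz].
move: {esz}(esz I I); elim: v w => [|x v IH] [|y w] //= [esz] /pI[-> e].
by rewrite (IH w).
Qed.

(** A map is determined by its graph, and coding pairs by points turns the graph into a subset of
    [T]. *)
Lemma card_le_endo (T : Type) : card_le (allX nat) (allX T) ->
  exists gr : (T -> T) -> T -> bool, injective gr.
Proof.
move=> infT; have [p pI] := card_le_square infT.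
exists (fun f z => `[< exists x, z = p x (f x) >]) => f g e.
apply/funext => x; have := congr1 (@^~ (p x (f x))) e => /= /esym.
rewrite [in RHS]asboolT; last by exists x.
by move=> /asboolP[y /pI[-> ->]].
Qed.

Lemma nat_powerset_card_le (T : Type) : card_le (allX nat) (allX T) ->
  exists F : (nat -> bool) -> T -> bool, injective F.
Proof.
move=> [io [_ ioI]]; exists (fun h x => `[< exists n, io n = x /\ h n >]) => h k e.
have hE (h' : nat -> bool) n : h' n = `[< exists m, io m = io n /\ h' m >].
  by apply/idP/asboolP => [h'n|[m [/(ioI _ _ I I) ->]]//]; exists n.
by apply/funext => n; rewrite (hE h) (hE k); exact: (congr1 (@^~ (io n)) e).
Qed.

(** The maps [p (io i)] have disjoint images, so [a] and [b] meet at most two of them, and one of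
    any three avoids both. *)
Lemma card_le_avoid2 (T : Type) (a b : T) : card_le (allX nat) (allX T) ->
  exists2 s : T -> T, injective s & forall x, s x <> a /\ s x <> b.
Proof.
move=> infT; have [io [_ ioI]] := infT; have [p pI] := card_le_square infT.
have [i ni] : exists i, forall x, p (io i) x <> a /\ p (io i) x <> b.
  apply: contrapT => /forallNP h.
  have {}h i : exists x, p (io i) x = a \/ p (io i) x = b.
    have /existsNP[x /not_andP[/contrapT e|/contrapT e]] := h i; exists x.
      by left.
    by right.
  have [x ex] := h 0; have [y ey] := h 1; have [z ez] := h 2.
  have np m n u v : m <> n -> p (io m) u = p (io n) v -> False.
    by move=> mn /pI[/(ioI _ _ I I)].
  by case: ex => ex; case: ey => ey; case: ez => ez;
    do ?[by apply: (np 0 1 x y) => //; rewrite ex ey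
        |by apply: (np 0 2 x z) => //; rewrite ex ez
        |by apply: (np 1 2 y z) => //; rewrite ey ez].
by exists (p (io i)) => // x y /pI[].
Qed.

(** Every generated map is the value of a word over [G], and such words are coded in [L]. *)
Lemma sgen_card_le (X L : Type) (G : (X -> X) -> Prop) :
  card_le (allX nat) (allX L) -> card_le G (allX L) -> card_le (sgen G) (allX L).
Proof.
move=> infL [c [_ cI]]; have [enc encI] := card_le_seq infL.
pose W := {f | G f}; pose ev (w : seq W) := foldr (fun g f => comp_tr (sval g) f) id w.
have evD v w : ev (v ++ w) = comp_tr (ev v) (ev w) by elim: v => //= g v ->.
have evS f : sgen G f -> exists w, ev w = f.
  elim=> [{}f Gf|{}f g _ [v <-] _ [w <-]]; first by exists [:: exist _ f Gf].
  by exists (v ++ w); rewrite evD.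
have /choice[d dP] f : exists w, sgen G f -> ev w = f.
  by have [/evS[w ew]|nGf] := pselect (sgen G f); [exists w|exists [::]].
exists (fun f => enc (map (c \o sval) (d f))); split=> // f g /dP ef /dP eg /encI e.
rewrite -ef -eg; congr ev; apply: inj_map e => -[x Gx] [y Gy] /= /cI exy.
by have := exy Gx Gy => exy'; subst; rewrite (Prop_irrelevance Gx Gy).
Qed.

Lemma nat_powerset_uncountable : ~ card_le (allX (nat -> bool)) (allX nat).
Proof.
move=> [F [_ FI]]; pose S n := `[< exists2 h, F h = n & h n = false >].
have [SS|SS] := boolP (S (F S)).
  have /asboolP[h /FI e] := SS; rewrite (e I I) => SF.
  by rewrite SF in SS.
by have /asboolP[] := SS; exists S => //; exact: negbTE.
Qed.

(** A finite [G] generates only countably many maps, too few for [K]; an infinite [G] generates no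
    more maps than it has elements. *)
Lemma card_le_of_sgen (X V : Type) (K : V -> Prop) (G : (X -> X) -> Prop) :
  card_le (allX (nat -> bool)) K -> card_le K (sgen G) -> card_le K G.
Proof.
move=> unc KG; have [[n /card_eq_le Gn]|/card_le_nat_infinite infG] := pselect (finite_set G).
  case: nat_powerset_uncountable; apply: card_le_trans unc _.
  apply: card_le_trans KG _; apply: sgen_card_le; first exact: card_le_refl.
  by apply: card_le_trans Gn _; exact: card_le_sub.
have GW : card_le G (allX {f | G f}).
  have [io [ioG _]] := infG.
  exists (fun f => if pselect (G f) is left Gf then exist _ f Gf else exist _ _ (ioG 0 I)).
  split=> // f g Gf Gg; case: pselect => // Gf'; case: pselect => // Gg' e.
  exact: (congr1 sval e).
apply: card_le_trans KG _; apply: card_le_trans (sgen_card_le (card_le_trans infG GW) GW) _.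
exists sval; split=> [[f Gf] _ //|[f Gf] [g Gg] _ _ /= e]; subst.
by rewrite (Prop_irrelevance Gf Gg).
Qed.

(** * Infinite rank *)

Lemma rank_idrankI (X K : Type) (S : (X -> X) -> Prop) (k : K -> Prop)
    (G : (X -> X) -> Prop) :
  generating_set S G -> (forall f, G f -> idempotent_tr f) -> card_eq G k ->
  (forall G', generating_set S G' -> card_le k G') -> rank_idrank_is S k.
Proof.
move=> gG idG Gk lek; split; split; do ?by exists G.
  by [].
by move=> G' gG' _; exact: lek.
Qed.

(** The set of all idempotents serves as the generating set: it is no larger than [k], and no
    smaller since it generates at least [k] maps. *)
Lemma rank_idrank_uncountable (X K : Type) (k0 : K) (T : (X -> X) -> Prop) (k : K -> Prop) :
  card_le (allX (nat -> bool)) k ->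
  card_le (fun f => T f /\ idempotent_tr f) k -> card_le k (Eid T) ->
  rank_idrank_is (Eid T) k.
Proof.
move=> unc idk kE.
apply: (@rank_idrankI _ _ _ _ (fun f => T f /\ idempotent_tr f)).
- by split=> // f; exact: sgen_base.
- by move=> f [].
- exact: card_le_anti (card_le_of_sgen unc kE).
- move=> G [GE EG]; apply: (card_le_of_sgen unc); apply: card_le_trans kE _.
  exact: card_le_sub.
Qed.

Lemma card_le_sig (U : Type) (P : U -> Prop) x : P x -> card_le P (allX {x | P x}).
Proof.
move=> Px; exists (fun y => if pselect (P y) is left Py then exist _ y Py else exist _ x Px).
split=> // y z Py Pz; case: pselect => // Py'; case: pselect => // Pz' e.
exact: (congr1 sval e).
Qed.

Lemma sig_card_le (U : Type) (P : U -> Prop) : card_le (allX {x | P x}) P.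
Proof.
exists sval; split=> [[x Px] _ //|[x Px] [y Py] _ _ /= e]; subst.
by rewrite (Prop_irrelevance Px Py).
Qed.

Lemma card_le_cprod (U V W : Type) (P : U -> Prop) (Q : V -> Prop) (R : W -> Prop) :
  card_le (allX nat) R -> card_le P R -> card_le Q R -> card_le (cprod_set P Q) R.
Proof.
move=> infR PR QR; have [io [ioR _]] := infR.
have RW := card_le_sig (ioR 0 I).
have [p pI] := card_le_square (card_le_trans infR RW).
have [f [_ fI]] := card_le_trans PR RW; have [g [_ gI]] := card_le_trans QR RW.
apply: card_le_trans _ (sig_card_le R).
exists (fun q => p (f q.1) (g q.2)); split=> // -[x y] [x' y'] [/= Px Qy] [/= Px' Qy'].
by move=> /pI[/fI -> // /gI ->].
Qed.

Lemma rank_idrank_TXA_infinite (X : Type) (A : X -> Prop) a b :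
  ~ finite_set (allX X) -> A a -> A b -> a <> b ->
  rank_idrank_is (Eid (TXA A)) (allX (X -> bool)).
Proof.
move=> /card_le_nat_infinite infX Aa Ab ab.
apply: rank_idrank_uncountable.
- exact: (fun=> true).
- have [F FI] := nat_powerset_card_le infX.
  by exists F; split=> // h k _ _ /FI.
- have [gr grI] := card_le_endo infX.
  by exists gr; split=> // f g _ _ /grI.
- have [s sI sab] := card_le_avoid2 a b infX.
  pose S (h : X -> bool) x := exists j, s j = x /\ h j.
  have Sa h : ~ S h a by move=> [j [ej _]]; have [] := sab j.
  have Sb h : ~ S h b by move=> [j [ej _]]; have [] := sab j.
  (* The subset [h] is coded by the idempotent [e h], which fixes [a] and [b]. Other points outside
     [S h] go to [a], while no point of [S h] does; hence [h j] fails exactly when [e h] sends [s j]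
     to [a]. *)
  pose e h x := if `[< S h x >] then (if `[< A x >] then x else b)
                else if `[< x = b >] then b else a.
  have ea h : e h a = a by rewrite /e (asboolF (Sa h)) (asboolF ab).
  have eb h : e h b = b by rewrite /e (asboolF (Sb h)) asboolT.
  exists e; split=> [h _|h k _ _ ehk].
    apply: sgen_base; split=> [x|]; first by rewrite /e; do 2 case: asboolP => // ?.
    apply/funext => x; rewrite /comp_tr {2 3}/e.
    case: asboolP => Sx; last by case: asboolP => _; rewrite ?ea ?eb.
    case: asboolP => Ax; rewrite ?eb //.
    by rewrite /e (asboolT Sx) (asboolT Ax).
  have eh h' j : h' j = ~~ `[< e h' (s j) = a >].
    apply/idP/idP => hj.
      apply/asboolPn; rewrite /e asboolT; last by exists j.
      by case: asboolP => _; [have [] := sab j|move=> /esym].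
    apply: contraNT hj => nh; apply/asboolP.
    rewrite /e asboolF; last by move=> [i [/sI ->]]; apply/negP.
    by rewrite asboolF //; have [] := sab j.
  by apply/funext => j; rewrite !eh ehk.
Qed.

(** The choice is made on predicates rather than points, so related points, whose classes are equal,
    get the same representative. *)
Lemma class_representatives (X : Type) (x0 : X) (alpha : X -> X -> Prop) :
  is_equivalence alpha -> exists rep : X -> X,
    (forall x, alpha x (rep x)) /\ (forall x y, alpha x y <-> rep x = rep y).
Proof.
move=> [refl [sym trans]].
have /choice[ch chP] (C : X -> Prop) : exists y, (exists z, C z) -> C y.
  by have [[z Cz]|nC] := pselect (exists z, C z); [exists z|exists x0].
have arep x : alpha x (ch (alpha x)) by apply: chP; exists x.
exists (fun x => ch (alpha x)); split=> // x y; split=> [xy|e].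
  congr ch; apply/funext => z; apply/propext; split; last exact: trans.
  by apply: trans; exact: sym.
by apply: (trans _ _ _ (arep x)); rewrite e; exact: sym.
Qed.

Lemma rank_idrank_TXalpha_infinite (X : Type) (x0 : X) (alpha : X -> X -> Prop) :
  is_equivalence alpha -> ~ finite_set (classes alpha) ->
  rank_idrank_is (Eid (TXalpha alpha))
    (cprod_set (class_powerset alpha) (class_product alpha)).
Proof.
move=> equiv /card_le_nat_infinite infC.
have [rep [arep repE]] := class_representatives x0 equiv.
have [refl [sym trans]] := equiv.
have repK x : rep (rep x) = rep x by apply/esym/repE.
(* [J] is a type of classes, each given by its representative, and [q] is the quotient map. *)
pose J := {x | rep x = x}; pose q x : J := exist _ (rep x) (repK x).
have qK (i : J) : q (sval i) = i.
  by case: i => x rx; apply: eq_exist => /=.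
have qE x y : alpha x y -> q x = q y by move=> /repE e; apply: eq_exist.
have infJ : card_le (allX nat) (allX J).
  apply: card_le_trans infC _.
  have /choice[f fP] (C : X -> Prop) : exists i : J, classes alpha C -> C = alpha (sval i).
    have [[x ->]|nC] := pselect (classes alpha C); last by exists (q x0).
    exists (q x) => _ /=; apply/funext => z; apply/propext; split; last first.
      by apply: trans; exact: arep.
    by apply: trans; apply: sym; exact: arep.
  by exists f; split=> // C D /fP eC /fP eD e; rewrite eC eD e.
have repP : class_product alpha rep by split=> // x y /repE.
have Pidem g : class_product alpha g -> idempotent_tr g.
  by move=> [ag ga]; apply/funext => x; rewrite /comp_tr; apply/ga/sym/ag.
have unc : card_le (allX (nat -> bool)) (class_powerset alpha).
  have [F FI] := nat_powerset_card_le infJ.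
  exists (fun h x => F h (q x)); split=> [h _ x y /qE -> //|h k _ _ e].
  by apply: FI; apply/funext => i; rewrite -(qK i); exact: (congr1 (@^~ (sval i)) e).
have powE : card_le (class_powerset alpha) (Eid (TXalpha alpha)).
  pose i0 := q x0; have [s sI si0] := card_le_avoid2 i0 i0 infJ.
  pose S (h : X -> bool) x := exists j, s j = q x /\ h (sval j).
  (* The classes coded by [h] are collapsed to their representatives and all others to that of [i0],
     which [s] avoids. Thus [h] holds at [j] exactly when [e h] fixes the representative [s j]. *)
  pose e h x := if `[< S h x >] then rep x else sval i0.
  have Srep h x : S h (rep x) = S h x by rewrite /S (qE (rep x) x) //; exact: sym.
  exists e; split=> [h ah|h k ah ak ehk].
    apply: sgen_base; split=> [x y xy|].
      by rewrite /e -(Srep _ x) -(Srep _ y) (iffLR (repE _ _) xy).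
    apply/funext => x; rewrite /comp_tr {2 3}/e; case: asboolP => Sx.
      by rewrite /e Srep asboolT // repK.
    by rewrite /e; case: asboolP => // _; rewrite /= repK.
  have eh h' (j : J) : h' (sval j) = `[< e h' (sval (s j)) = sval (s j) >].
    apply/idP/asboolP => hj.
      by rewrite /e asboolT ?(svalP (s j)) //; exists j; rewrite qK.
    apply: contrapT => nh; have [+ _] := si0 j; apply.
    rewrite -(qK (s j)) -hj /e asboolF ?qK // => -[i []].
    by rewrite qK => /sI ->.
  apply/funext => x; rewrite (ah _ _ (arep x)) (ak _ _ (arep x)).
  by rewrite (eh _ (q x)) ehk (eh _ (q x)).
apply: rank_idrank_uncountable.
- exact: (fun=> true, id).
- apply: card_le_trans unc _.
  by exists (fun h => (h, rep)); split=> // h k _ _ [].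
- have [gr grI] := card_le_endo infJ.
  (* An idempotent [e] is coded by its induced map on classes and by [g e], which picks in each
     class the point fixed by [e], if there is one. This determines [e]: the first component gives
     the class of [e x], and [e x] is the fixed point there. *)
  pose g (e : X -> X) x := if `[< alpha (e x) x >] then e x else rep x.
  exists (fun e => (fun x => gr (fun i => q (e (sval i))) (q x), g e)).
  split=> [e [Te ide]|e e' [Te ide] [Te' ide'] [egr eg]].
    split=> /= [x y /qE -> //|]; split=> x.
      by rewrite /g; case: asboolP => //; exact: sym.
    move=> y xy; rewrite /g (Te _ _ xy) (iffLR (repE _ _) xy).
    suff -> : alpha (e y) x = alpha (e y) y by [].
    by apply/propext; split=> h; apply: trans h _ => //; exact: sym.
  have {}egr : (fun i : J => q (e (sval i))) = (fun i : J => q (e' (sval i))).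
    by apply: grI; apply/funext => i; have := congr1 (@^~ (sval i)) egr; rewrite /= qK.
  have gE f i : TXalpha alpha f -> idempotent_tr f ->
      g f (sval (q (f i))) = f i.
    move=> Tf idf; have fE : f (rep (f i)) = f i.
      by rewrite -(Tf _ _ (arep _)); exact: (congr1 (@^~ i) idf).
    by rewrite /g /= fE asboolT.
  apply/funext => x; rewrite (Te _ _ (arep x)) (Te' _ _ (arep x)).
  have := congr1 (@^~ (q x)) egr => /= eq.
  by rewrite -(gE e) // eq eg gE.
(* Each factor embeds in the semigroup, which is infinite, so their product embeds too. *)
- apply: card_le_cprod => //.
    apply: card_le_trans (card_le_trans unc powE).
    exists (fun n m => m == n); split=> // m n _ _ /(congr1 (@^~ m)).
    by rewrite eqxx => /esym/eqP.
  by apply: card_le_sub => f fP; apply: sgen_base; split; [case: fP|exact: Pidem].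
Qed.

(** * Idempotents of finite full transformation monoids *)

Lemma sgen_sub (X : Type) (G H : (X -> X) -> Prop) f :
  (forall g, G g -> sgen H g) -> sgen G f -> sgen H f.
Proof. by move=> GH; elim=> [g /GH//|g h _ sg _ sh]; exact: sgen_comp. Qed.

(** An injective idempotent is the identity, and the first factor of an injective product is
    injective, so factors can be removed from the left. *)
Lemma Eid_injective (X : Type) (T : (X -> X) -> Prop) f : Eid T f -> injective f -> f = id.
Proof.
elim=> [{}f [_ idf] fI|{}f g _ IHf _ IHg fgI].
  by apply/funext => x; apply: fI; exact: (congr1 (@^~ x) idf).
have fid : f = id by apply: IHf => x y e; apply: fgI; rewrite /comp_tr e.
by rewrite fid; apply: IHg => x y e; apply: fgI; rewrite /comp_tr fid.
Qed.

(** For distinct [u] and [v] these are the idempotents of defect one: only [u] leaves the image. *)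
Definition arc (T : eqType) (u v w : T) : T := if w == u then v else w.

Lemma arc_kernel (T : eqType) (u v a b : T) :
  a != b -> arc u v a = arc u v b -> (a = u /\ b = v) \/ (a = v /\ b = u).
Proof.
rewrite /arc; case: (eqVneq a u) => [->|_]; case: (eqVneq b u) => [->|_].
- by [].
- by left.
- by right.
- by move=> /[swap] ->; rewrite eqxx.
Qed.

Lemma idempotent_arc (T : eqType) (u v : T) : idempotent_tr (arc u v).
Proof.
apply/funext => w; rewrite /comp_tr /arc.
by case: (eqVneq w u) => [_|/negPf ->//]; case: ifP.
Qed.

(** Induction on the number of moved points: a moved point [u] is first sent to [e u], and what
    remains to be done is an idempotent [e'] that fixes [u] and otherwise agrees with [e]. *)
Lemma idempotent_sgen_arc (T : finType) (e : T -> T) : idempotent_tr e -> e <> id ->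
  sgen (fun f => exists u v, u != v /\ f = arc u v) e.
Proof.
move: {2}(#|[pred x | e x != x]|) (erefl #|[pred x | e x != x]|) => n.
elim: n e => [|n IH] e en ide nid.
  case: nid; apply/funext => x; apply/eqP; apply: contraT => ex.
  by have := card0_eq en x; rewrite inE ex.
have eK x : e (e x) = e x := congr1 (@^~ x) ide.
have [u /= eu] : exists u, e u != u.
  have /card_gt0P[u] : 0 < #|[pred x | e x != x]| by rewrite en.
  by rewrite inE; exists u.
pose e' w := if w == u then u else e w.
have ee' : e = comp_tr (arc u (e u)) e'.
  apply/funext => w; rewrite /comp_tr /arc /e'.
  by case: (eqVneq w u) => [->|/negPf ->//]; rewrite (negPf eu) eK.
have arcu : sgen (fun f => exists u v, u != v /\ f = arc u v) (arc u (e u)).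
  by apply: sgen_base; exists u, (e u); split; rewrite // eq_sym.
have [e'id|ne'id] := pselect (e' = id); first by rewrite ee' e'id.
rewrite ee'; apply: sgen_comp => //; apply: IH => //.
  move: en; rewrite (cardD1 u) inE eu => -[<-]; apply: eq_card => x.
  by rewrite !inE /e'; case: (eqVneq x u) => [->|_]; rewrite ?eqxx.
apply/funext => w; rewrite /comp_tr {2 3}/e'; case: (eqVneq w u) => [_|wu].
  by rewrite /e' eqxx.
(* The value [u] does not occur, since an idempotent fixes its image and [e] moves [u]. *)
rewrite /e'; case: eqP => [ew|_]; last exact: eK.
by move: eu; rewrite -ew eK eqxx.
Qed.

(* Rotating the three arcs twice around the cycle [x -> y -> z -> x] moves the
   vacated point, and hence the two identified points, to the reversed arc. *)
Lemma sgen_arc_3cycle (T : eqType) (G : (T -> T) -> Prop) (x y z : T) :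
  x != y -> y != z -> z != x ->
  sgen G (arc x y) -> sgen G (arc y z) -> sgen G (arc z x) -> sgen G (arc y x).
Proof.
move=> xy yz zx sxy syz szx.
suff -> : arc y x = comp_tr (arc x y) (comp_tr (arc z x) (comp_tr (arc y z)
    (comp_tr (arc x y) (comp_tr (arc z x) (arc y z))))).
  by do ![apply: sgen_comp => //].
have [yx zy xz] : [/\ y != x, z != y & x != z] by split; rewrite eq_sym.
have E := (negPf xy, negPf yz, negPf zx, negPf yx, negPf zy, negPf xz, eqxx).
apply/funext => w; rewrite /comp_tr /arc.
case: (eqVneq w x) => [->|wx]; first by rewrite !E.
case: (eqVneq w y) => [->|wy]; first by rewrite !E.
case: (eqVneq w z) => [->|wz]; first by rewrite !E.
by rewrite !(negPf wx, negPf wy, negPf wz).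
Qed.

(* The property [Q i] of a product passes to one of its factors, so that each [i]
   costs any generating set a generator of its own. *)
Definition irredundant_family (T : Type) (m : nat)
    (e : 'I_m -> T -> T) (Q : 'I_m -> (T -> T) -> Prop) : Prop :=
  [/\ forall i, idempotent_tr (e i) /\ Q i (e i),
      forall i s, Q i s -> s <> id,
      forall i j s, Q i s -> Q j s -> i = j,
      forall f, idempotent_tr f -> f <> id -> sgen (fun g => exists i, g = e i) f &
      forall i s t, Eid (fun=> True) s -> Eid (fun=> True) t ->
        Q i (comp_tr s t) -> Q i s \/ Q i t].

(** On two points a product of idempotents is the identity or a constant. The two constants share
    one kernel, so [Q i] records the value instead. *)
Lemma irredundant_family2 : exists e Q, @irredundant_family 'I_2 2 e Q.
Proof.
pose Q i (s : 'I_2 -> 'I_2) := s = fun=> i.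
have I2 (i : 'I_2) : i = ord0 \/ i = ord_max.
  by case: i => -[|[|//]] ?; [left|right]; apply: val_inj.
have idc (s : 'I_2 -> 'I_2) : Eid (fun=> True) s -> s = id \/ exists c, s = fun=> c.
  move=> Es; have [e|ne] := eqVneq (s ord0) (s ord_max).
    by right; exists (s ord0); apply/funext => i; case: (I2 i) => ->.
  left; apply: Eid_injective Es _ => i j.
  by case: (I2 i) => ->; case: (I2 j) => -> // e; rewrite e eqxx in ne.
exists (fun i => fun=> i), Q; split.
- by move=> i; split.
- move=> i s -> /(congr1 (fun f : 'I_2 -> 'I_2 => (f ord0, f ord_max))).
  by move=> [] ->.
- by move=> i j s -> /(congr1 (@^~ ord0)).
- move=> f idf nid; apply: sgen_base.
  by have [|//|] := idc f; first by apply: sgen_base.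
- move=> i s t /idc[->|[c ->]] /idc[->|[d ->]]; rewrite /Q /comp_tr => e.
  + by right.
  + by right.
  + by left.
  + by right; apply/funext => j; exact: (congr1 (@^~ ord0) e).
Qed.

Lemma card_ord_lt_pairs k : #|[pred p : 'I_k * 'I_k | p.1 < p.2]| = 'C(k, 2).
Proof.
rewrite -sum1_card (eq_bigl (fun p : 'I_k * 'I_k => p.1 < p.2)) //.
rewrite -(pair_big_dep xpredT (fun i j : 'I_k => i < j) (fun _ _ => 1)) /=.
rewrite (exchange_big_dep xpredT) //= -bin2_sum big_mkord.
apply: eq_bigr => j _; rewrite (big_ord_narrow (ltnW (ltn_ord j))) /=.
by rewrite sum_nat_const card_ord muln1.
Qed.

(** The generators form the transitive tournament with the single edge between its least and
    greatest points reversed. It is strongly connected for at least three points, and reversing arcs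
    along 3-cycles yields all the others. *)
Lemma sgen_tournament (k : nat) (u v : 'I_k) : k != 2 -> u != v ->
  sgen (fun f => exists i j : 'I_k, i < j /\
    f = if (i == 0 :> nat) && (j.+1 == k) then arc j i else arc i j) (arc u v).
Proof.
set G := (X in sgen X); move=> k2 uv.
have k3 : 2 < k.
  move: uv; case: k u v k2 {G} => [|[|[|k]]] // u v _; first by case: u.
  by rewrite !ord1 eqxx.
(* From here on [k] is the greatest point, one less than the number of points. *)
case: k k2 k3 u v @G uv => [//|k] _ k3 u v G uv.
have fwd (i j : 'I_k.+1) : i < j -> (i != ord0) || (j != ord_max) -> sgen G (arc i j).
  move=> ij /orP h; apply: sgen_base; exists i, j; split=> //.
  case: ifP => // /andP[/eqP i0 /eqP /succn_inj jk]; case: h => /eqP[].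
    exact: val_inj.
  exact: val_inj.
have bwd : sgen G (arc ord_max ord0).
  apply: sgen_base; exists ord0, ord_max; rewrite /= !eqxx; split=> //.
  by rewrite -ltnS ltnW.
have [mid [m0 mk]] : exists i : 'I_k.+1, 0 < i /\ i < k.
  by exists (inord 1); rewrite inordK // ltnS ltnW // -ltnS.
have neq (i j : 'I_k.+1) : i < j -> (i != j) && (j != i).
  by move=> ij; rewrite [j == i]eq_sym andbb; apply: contraTneq ij => ->; rewrite ltnn.
have max0 : 0 < k by apply: leq_trans mk.
(* Every interior vertex [m] lies on the 3-cycle [0 -> m -> k -> 0]. *)
have both (m : 'I_k.+1) : 0 < m -> m < k ->
    [/\ sgen G (arc ord0 m), sgen G (arc m ord_max), sgen G (arc ord_max ord0),
        sgen G (arc m ord0) & [/\ sgen G (arc ord_max m) & sgen G (arc ord0 ord_max)]].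
  move=> lt0 ltk; have a1 : sgen G (arc ord0 m).
    by apply: fwd => //; apply/orP; right; apply: contraTneq ltk => ->; rewrite ltnn.
  have a2 : sgen G (arc m ord_max).
    by apply: fwd => //; apply/orP; left; apply: contraTneq lt0 => ->; rewrite ltnn.
  have /andP[n1 n1'] := neq ord0 m lt0; have /andP[n2 n2'] := neq m ord_max ltk.
  have /andP[n3 n3'] := neq ord0 ord_max max0.
  split=> //; last split.
  - exact: (sgen_arc_3cycle n1 n2 n3').
  - exact: (sgen_arc_3cycle n2 n3' n1).
  - exact: (sgen_arc_3cycle n3' n1 n2).
have from0 (m : 'I_k.+1) : 0 < m -> sgen G (arc ord0 m) /\ sgen G (arc m ord0).
  move=> lt0; have [mk'|km] := ltnP m k; first by have [? _ _ ? _] := both m lt0 mk'.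
  have -> : m = ord_max by apply: val_inj; apply/eqP; rewrite eqn_leq km -ltnS ltn_ord.
  by have [_ _ ? _ [_ ?]] := both mid m0 mk.
have [] := ltngtP u v; last by move=> /val_inj e; rewrite e eqxx in uv.
  move=> ltuv; have [v0|nv] := boolP (v == ord_max); last first.
    by apply: fwd; rewrite ?nv ?orbT.
  have [/eqP ->|nu] := boolP (u == ord0); last by apply: fwd; rewrite ?nu.
  by have [] := from0 v; rewrite ?(eqP v0).
move=> ltvu; have [/eqP ->|nv] := boolP (v == ord0).
  by have [] := from0 u (leq_ltn_trans (leq0n _) ltvu).
have lt0v : 0 < v by rewrite lt0n; apply: contraNneq nv => v0; apply/eqP/val_inj.
have [_ u0] := from0 u (ltn_trans lt0v ltvu); have [v0 _] := from0 v lt0v.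
(* The cycle [v -> u -> 0 -> v] reverses this arc. *)
have vu : sgen G (arc v u) by apply: fwd; rewrite ?nv.
have /andP[n1 n1'] := neq v u ltvu; have /andP[n2 n2'] := neq ord0 v lt0v.
have /andP[n3 n3'] := neq ord0 u (ltn_trans lt0v ltvu).
exact: (sgen_arc_3cycle n1 n3' n2).
Qed.

(** [Q i s] says that [s] identifies the [i]-th pair and no other. If a product [s t] does so,
    either [s] is injective, hence the identity, and [t] does so, or [s] identifies some pair, which
    must be that one. *)
Lemma irredundant_family_bin2 (k : nat) : k != 2 ->
  exists e Q, @irredundant_family 'I_k 'C(k, 2) e Q.
Proof.
move=> k2; pose rk := cast_ord (esym (card_ord_lt_pairs k)).
pose pr (i : 'I_('C(k, 2))) : 'I_k * 'I_k := enum_val (rk i).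
have prlt i : (pr i).1 < (pr i).2 by have := enum_valP (rk i).
have prI : injective pr by move=> i j /enum_val_inj /cast_ord_inj.
have prS (u v : 'I_k) : u < v -> exists i, pr i = (u, v).
  move=> uv; have Puv : (u, v) \in [pred p : 'I_k * 'I_k | p.1 < p.2] by [].
  exists (cast_ord (card_ord_lt_pairs k) (enum_rank_in Puv (u, v))).
  by rewrite /pr /rk cast_ordK enum_rankK_in.
pose e i := let: (u, v) := pr i in
  if (u == 0 :> nat) && (v.+1 == k) then arc v u else arc u v.
pose Q i (s : 'I_k -> 'I_k) := s (pr i).1 = s (pr i).2 /\
  forall u v : 'I_k, u < v -> s u = s v -> (u, v) = pr i.
exists e, Q; split.
- move=> i; have := prlt i; rewrite /e /Q; case: (pr i) => u v /= uv.
  split; first by case: ifP => _; exact: idempotent_arc.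
  split; first by case: ifP => _; rewrite /arc !eqxx; case: eqP => // ->.
  have nuv : u != v by apply: contraTneq uv => ->; rewrite ltnn.
  move=> u' v' uv'; have nuv' : u' != v' by apply: contraTneq uv' => ->; rewrite ltnn.
  case: ifP => _ /(arc_kernel nuv')[] [eu ev]; subst => //;
    by have := ltn_trans uv uv'; rewrite ltnn.
- move=> i s [es _] sid; have := prlt i; rewrite sid in es.
  by rewrite es ltnn.
- move=> i j s [es _] [_ sj]; apply: prI; rewrite [pr i]surjective_pairing.
  by apply: sj; first exact: prlt.
- move=> f idf nid; apply: sgen_sub (idempotent_sgen_arc idf nid) => _ [u [v [uv ->]]].
  apply: sgen_sub (sgen_tournament k2 uv) => _ [i [j [ij ->]]]; apply: sgen_base.
  by have [p ep] := prS _ _ ij; exists p; rewrite /e ep.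
- move=> i s t Es Et [est st].
  have [sI|/existsNP[u /existsNP[v /not_implyP[suv /eqP uv]]]] := pselect (injective s).
    by right; split; move: est st; rewrite /comp_tr (Eid_injective Es sI).
  left; wlog ltuv : u v suv uv / u < v.
    move=> th; have [|vu|e'] := ltngtP u v; first exact: th.
      by apply: (th v u); rewrite // eq_sym.
    by rewrite (val_inj e') eqxx in uv.
  have euv : (u, v) = pr i by apply: st => //; rewrite /comp_tr suv.
  split; first by rewrite -euv.
  by move=> a b ab sab; apply: st => //; rewrite /comp_tr sab.
Qed.

(** * Finitely many points in the image or finitely many classes *)

(* Both parts of the theorem are instances: [a] enumerates the set [A] or a system
   of class representatives, [c] is a retraction of [X] onto the indices, and
   [qmap f] is the restriction of [f] to [A] or the map it induces on classes. *)
Section FiniteQuotient.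
Variables (X : Type) (T : (X -> X) -> Prop) (k : nat) (a : 'I_k -> X) (c : X -> 'I_k).

Definition qmap (f : X -> X) : 'I_k -> 'I_k := fun i => c (f (a i)).
Definition qlift (s : 'I_k -> 'I_k) : X -> X := fun x => a (s (c x)).
Definition qkernel (f : X -> X) : Prop := T f /\ qmap f = id.

Hypothesis aK : cancel a c.
Hypothesis T_comp : forall f g, T f -> T g -> T (comp_tr f g).
Hypothesis T_lift : forall s, T (qlift s).
(** This makes [qmap] multiplicative. Either [f (a i)] is already one of the points [a j], or [g] is
    constant on classes. *)
Hypothesis T_repr : forall f g i, T f -> T g -> g (f (a i)) = g (a (c (f (a i)))).
Hypothesis kernel_band : forall p q, qkernel p -> qkernel q ->
  comp_tr p q = p \/ comp_tr p q = q.
(** The order depends on the instance: a retraction onto [A] acts first, a choice function last. *)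
Hypothesis factor : forall f, Eid T f -> exists2 p, qkernel p &
  f = comp_tr p (qlift (qmap f)) \/ f = comp_tr (qlift (qmap f)) p.
Variables (m : nat) (e : 'I_m -> 'I_k -> 'I_k) (Q : 'I_m -> ('I_k -> 'I_k) -> Prop).
Hypothesis eQ : irredundant_family e Q.

Let qmap_comp f g : T f -> T g -> qmap (comp_tr f g) = comp_tr (qmap f) (qmap g).
Proof. by move=> Tf Tg; apply/funext => i; rewrite /qmap /comp_tr (T_repr i Tf Tg). Qed.

Let qliftK : cancel qlift qmap.
Proof. by move=> s; apply/funext => i; rewrite /qmap /qlift !aK. Qed.

Let qlift_comp s t : qlift (comp_tr s t) = comp_tr (qlift s) (qlift t).
Proof. by apply/funext => x; rewrite /comp_tr /qlift aK. Qed.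

Let Eid_T f : Eid T f -> T f.
Proof. by elim=> [{}f []//|{}f g _ Tf _ Tg]; exact: T_comp. Qed.

Let Eid_qmap f : Eid T f -> Eid (fun=> True) (qmap f).
Proof.
elim=> [{}f [Tf idf]|{}f g /Eid_T Tf Ef /Eid_T Tg Eg].
  by apply: sgen_base; split; rewrite // /idempotent_tr -qmap_comp // idf.
by rewrite qmap_comp //; exact: sgen_comp.
Qed.

Let qkernel_idempotent p : qkernel p -> idempotent_tr p.
Proof. by move=> Pp; case: (kernel_band Pp Pp). Qed.

Let qkernel_Eid p : qkernel p -> Eid T p.
Proof. by move=> Pp; apply: sgen_base; split; [case: Pp|exact: qkernel_idempotent]. Qed.

Let qkernel1 : qkernel (qlift id).
Proof. by split; [exact: T_lift|exact: qliftK]. Qed.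

Let qgen f := qkernel f \/ exists i, f = qlift (e i).

Let qlift_idempotent i : idempotent_tr (qlift (e i)).
Proof. by have [/(_ i)[ei _] _ _ _ _] := eQ; rewrite /idempotent_tr -qlift_comp ei. Qed.

Let qgen_generates : generating_set (Eid T) qgen.
Proof.
split=> [f [/qkernel_Eid//|[i ->]]|f Ef].
  by apply: sgen_base; split; [exact: T_lift|exact: qlift_idempotent].
have lift_gen s : sgen (fun g => exists i, g = e i) s -> sgen qgen (qlift s).
  elim=> [_ [i ->]|s1 s2 _ g1 _ g2]; first by apply: sgen_base; right; exists i.
  by rewrite qlift_comp; exact: sgen_comp.
have [_ _ _ egen _] := eQ.
(* The identity is a separate case, as the [e i] are only known to generate the other idempotents;
   its lift belongs to the kernel. *)
have split_id s : Eid (fun=> True) s -> s = id \/ sgen (fun g => exists i, g = e i) s.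
  elim=> [{}s [_ ids]|s1 s2 _ g1 _ g2].
    by have [|nid] := pselect (s = id); [left|right; exact: egen].
  by case: g1 => [->|g1]; case: g2 => [->|g2]; [left|right|right|right; exact: sgen_comp].
have lift_qmap : sgen qgen (qlift (qmap f)).
  case: (split_id _ (Eid_qmap Ef)) => [->|]; last exact: lift_gen.
  by apply: sgen_base; left; exact: qkernel1.
have [p Pp [->|->]] := factor Ef; apply: sgen_comp => //; by apply: sgen_base; left.
Qed.

(** Realises [m] plus the kernel by maps, with index [i] at [h i]; the value [id] is a default for
    numbers not below [m]. *)
Let place (h : 'I_m -> X -> X) (s : nat + (X -> X)) : X -> X :=
  match s with inl n => oapp h id (insub n) | inr p => p end.

(** The properties [Q i] exclude each other and the identity, so the [h i] are distinct and lie
    outside the kernel. *)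
Let place_inj h : (forall i, Q i (qmap (h i))) ->
  forall s t, nat_plus m qkernel s -> nat_plus m qkernel t -> place h s = place h t -> s = t.
Proof.
have [_ Qid Qinj _ _] := eQ.
move=> hQ [n|p] [n'|p'] /= hs ht; rewrite ?insubT /=.
- move=> hh; have Qn := hQ (Sub n hs); have Qn' := hQ (Sub n' ht).
  by rewrite -hh in Qn'; have [->] := Qinj _ _ _ Qn Qn'.
- by move=> hp; have /Qid := hQ (Sub n hs); rewrite hp; case: ht.
- by move=> hp; have /Qid := hQ (Sub n' ht); rewrite -hp; case: hs.
- by move=> ->.
Qed.

(** If a product induces the identity, its first factor induces an injective map, hence the
    identity, and so does the second. Both lie in the band, where the product equals one of them. *)
Let qkernel_sgen G f : generating_set (Eid T) G -> sgen G f -> qkernel f -> G f.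
Proof.
move=> [GE _]; elim=> // {}f g sf IHf sg IHg Pfg.
have [Ef Eg] : Eid T f /\ Eid T g by split; [move: sf|move: sg]; exact: sgen_sub.
have [_] := Pfg; rewrite qmap_comp; do ?exact: Eid_T.
move=> fgid; have fid : qmap f = id.
  apply: Eid_injective (Eid_qmap Ef) _ => i j eij.
  by have := congr1 (@^~ i) fgid; rewrite /comp_tr eij => <-; exact: (congr1 (@^~ j) fgid).
have gid : qmap g = id by rewrite -[RHS]fgid fid.
have Pf : qkernel f by split=> //; exact: Eid_T.
have Pg : qkernel g by split=> //; exact: Eid_T.
by case: (kernel_band Pf Pg) => ->; [exact: IHf|exact: IHg].
Qed.

Let Q_sgen G f i : generating_set (Eid T) G -> sgen G f -> Q i (qmap f) ->
  exists2 g, G g & Q i (qmap g).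
Proof.
have [_ _ _ _ Qcomp] := eQ.
move=> [GE _]; elim=> [{}f Gf Qf|{}f g sf IHf sg IHg]; first by exists f.
have [Ef Eg] : Eid T f /\ Eid T g by split; [move: sf|move: sg]; exact: sgen_sub.
rewrite qmap_comp; do ?exact: Eid_T.
by move=> /Qcomp[]; [exact: Eid_qmap|exact: Eid_qmap|exact: IHf|exact: IHg].
Qed.

Lemma rank_idrank_nat_plus : rank_idrank_is (Eid T) (nat_plus m qkernel).
Proof.
have [eidQ _ _ _ _] := eQ.
apply: (rank_idrankI qgen_generates).
- by move=> f [/qkernel_idempotent|[i ->]].
- apply: (card_eq_sym (inr id)); exists (place (qlift \o e)); split; last split.
  + by move=> [n|p] /= hs; [rewrite insubT; right; eexists|left].
  + by apply: place_inj => i /=; rewrite qliftK; have [] := eidQ i.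
  + move=> f [Pf|[i ->]]; first by exists (inr f).
    by exists (inl (val i)); rewrite /= ?valK.
move=> G gG; have [_ Egen] := gG.
(* Each [Q i] passes down to a generator [h i]; together with the kernel these embed the claimed
   cardinal in [G]. *)
have /choice[h hP] i : exists g, G g /\ Q i (qmap g).
  have /Egen /(Q_sgen gG) : Eid T (qlift (e i)).
    by apply: sgen_base; split; [exact: T_lift|exact: qlift_idempotent].
  by move=> /(_ i)[|g Gg Qg]; [rewrite qliftK; have [] := eidQ i|exists g].
exists (place h); split; last by apply: place_inj => i; have [] := hP i.
move=> [n|p] /= hs; first by rewrite insubT /=; have [] := hP (Sub n hs).
by apply: (qkernel_sgen gG) => //; apply: Egen; exact: qkernel_Eid.
Qed.

End FiniteQuotient.

(** * Transport of ranks and finite counting *)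

Lemma rank_idrank_card_eq (X K L : Type) (u0 : K) (S : (X -> X) -> Prop)
    (k : K -> Prop) (l : L -> Prop) :
  card_eq k l -> rank_idrank_is S k -> rank_idrank_is S l.
Proof.
move=> kl [[_ lek] [[G [gG [idG Gk]]] _]].
apply: (rank_idrankI gG idG (card_eq_trans Gk kl)) => G' gG'.
exact: card_le_trans (card_eq_le (card_eq_sym u0 kl)) (lek _ gG').
Qed.

Lemma has_card_ord (U : Type) (P : U -> Prop) n u : P u -> has_card P n ->
  exists (a : 'I_n -> U) (c : U -> 'I_n),
    [/\ forall i, P (a i), cancel a c & forall x, P x -> a (c x) = x].
Proof.
move=> Pu [f [fP [fI fS]]].
have /choice[a aP] (i : 'I_n) : exists x, P x /\ f x = i.
  by have [x Px fx] := fS i (ltn_ord i); exists x.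
(* The index of [u] is the default when [f x] is not below [n], which happens only outside [P]. *)
exists a, (fun x => insubd (Ordinal (fP u Pu)) (f x)); split=> [i|i|x Px].
- by have [] := aP i.
- by have [Pa fa] := aP i; apply: val_inj; rewrite val_insubd fa ltn_ord.
- have [Pa fa] := aP (insubd (Ordinal (fP u Pu)) (f x)).
  by apply: fI => //; rewrite fa val_insubd fP.
Qed.

Lemma has_card_fin (U : Type) (F : finType) (P : U -> Prop) :
  card_eq P (allX F) -> has_card P #|F|.
Proof.
move=> PF; apply: card_eq_trans PF _; exists (fun x => val (enum_rank x)).
split=> [x _|]; first exact: ltn_ord.
split=> [x y _ _ /val_inj/enum_rank_inj //|n nF].
by exists (enum_val (Ordinal nF)); rewrite ?enum_valK.
Qed.

Lemma card_le_fin (U : Type) (F : finType) (P : U -> Prop) :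
  card_le P (allX F) -> finite_set P.
Proof.
move=> /card_le_mathcomp h; have [n Pn] : cardinality.finite_set P.
  by apply: cardinality.card_le_finite h _; exact: cardinality.finite_finset.
by exists n; exact: (card_eq_mathcomp 0 Pn).
Qed.

Lemma has_card_nat_plus (V : Type) m (P : V -> Prop) N :
  has_card P N -> has_card (nat_plus m P) (m + N).
Proof.
move=> [f [fP [fI fS]]].
exists (fun s => match s with inl k => k | inr v => m + f v end); split.
  move=> [k|v] /= h; first exact: leq_trans h (leq_addr _ _).
  by rewrite ltn_add2l; exact: fP.
split=> [[k|v] [k'|v'] /= h h'|k].
- by move=> ->.
- by move=> e; rewrite e ltnNge leq_addr in h.
- by move=> e; rewrite -e ltnNge leq_addr in h'.
- by move=> /addnI /fI ->.
have [km|mk] := ltnP k m; first by exists (inl k).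
move=> kmN; have [v Pv fv] : exists2 v, P v & f v = k - m.
  by apply: fS; rewrite ltn_subLR.
by exists (inr v); rewrite // fv subnKC.
Qed.

(** * Maps with image in a finite set *)

Definition retraction (X : Type) (A : X -> Prop) (f : X -> X) : Prop :=
  TXA A f /\ forall x, A x -> f x = x.

Lemma rank_idrank_TXA (X : Type) (A : X -> Prop) (k : nat) x m e Q :
  A x -> has_card A k -> @irredundant_family 'I_k m e Q ->
  rank_idrank_is (Eid (TXA A)) (nat_plus m (retraction A)).
Proof.
move=> Ax /(has_card_ord Ax)[a [c [aA aK cK]]] eQ.
have kerE : qkernel (TXA A) a c = retraction A.
  apply/funext => f; apply/propext; split=> -[Tf h]; split=> //.
    move=> y Ay; have := congr1 (@^~ (c y)) h; rewrite /qmap cK // => hc.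
    by rewrite -(cK _ (Tf y)) hc cK.
  by apply/funext => i; rewrite /qmap h.
rewrite -kerE; apply: rank_idrank_nat_plus eQ => //.
- by move=> f g _ Tg y; exact: Tg.
- by move=> s y; exact: aA.
- by move=> f g i Tf _; rewrite cK.
- rewrite kerE => p q [Tp _] [_ q1]; left; apply/funext => y; rewrite /comp_tr q1 //.
- move=> f Ef; have Tf : TXA A f.
    by elim: Ef => [{}f []//|{}f g _ _ _ Tg y]; exact: Tg.
  (* The first idempotent factor of [f] moves [y] into [A] without changing its value under [f]. A
     retraction sending [y] to such a point, followed by [f] on [A], is therefore [f]. *)
  have /choice[z zP] y : exists z, A z /\ f z = f y.
    elim: Ef y {Tf} => [{}f [Tf idf] y|{}f g _ IHf _ _ y].
      by exists (f y); split; [exact: Tf|exact: (congr1 (@^~ y) idf)].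
    by have [z [Az fz]] := IHf y; exists z; rewrite /comp_tr fz.
  exists (fun y => if `[< A y >] then y else z y).
    rewrite kerE; split=> [y|y Ay]; last by rewrite asboolT.
    by case: asboolP => // _; have [] := zP y.
  left; apply/funext => y; rewrite /comp_tr /qlift /qmap.
  have lift w : A w -> a (c (f (a (c w)))) = f w by move=> Aw; rewrite !cK.
  by case: asboolP => [/lift //|_]; have [Az <-] := zP y; rewrite lift.
Qed.

(** A retraction is forced on [A] and takes any of [k] values at each of the remaining [n - k]
    points. *)
Lemma has_card_retraction (X : Type) (A : X -> Prop) n k x :
  A x -> has_card (allX X) n -> has_card A k -> has_card (retraction A) (k ^ (n - k)).
Proof.
move=> Ax /(has_card_ord (I : allX X x))[b [d [_ bK dK]]] /(has_card_ord Ax)[a [c [aA aK cK]]].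
pose inA (i : 'I_n) := `[< A (b i) >]; pose F := {ffun {i | ~~ inA i} -> 'I_k}.
have cardA : #|inA| = k.
  rewrite -[RHS]card_ord -(card_codom (f := d \o a)).
    apply: eq_card => i; apply/asboolP/codomP => [Ai|[j ->]].
      by exists (c (b i)); rewrite /= cK // bK.
    by rewrite /= dK.
  by apply: can_inj (c \o b) _ => j /=; rewrite dK // aK.
have <- : #|F| = k ^ (n - k).
  rewrite card_ffun card_ord card_sig; congr (_ ^ _).
  by rewrite -[n in RHS]card_ord -(cardC inA) cardA addKn; apply: eq_card.
apply: has_card_fin; exists (fun f => [ffun i => c (f (b (val i)))]).
split=> //; split=> [f g [Tf f1] [Tg g1] /ffunP e|phi _].
  apply/funext => y; have [Ay|nAy] := pselect (A y); first by rewrite f1 ?g1.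
  have ndy : ~~ inA (d y) by apply/asboolPn; rewrite dK.
  have := e (Sub (d y) ndy); rewrite !ffunE /= dK // => /(congr1 a).
  by rewrite !cK.
exists (fun y => if insub (d y) is Some i then a (phi i) else y).
  split=> y; case: insubP => [i|]; rewrite ?negbK.
  - by [].
  - by move=> /asboolP; rewrite dK.
  - by move=> /asboolPn + _ Ay; rewrite dK.
  - by [].
by apply/ffunP => i; rewrite ffunE bK valK aK.
Qed.

(** * Maps constant on finitely many classes *)

Lemma rank_idrank_TXalpha (X : Type) (x0 : X) (alpha : X -> X -> Prop) (k : nat) m e Q :
  is_equivalence alpha -> has_card (classes alpha) k -> @irredundant_family 'I_k m e Q ->
  rank_idrank_is (Eid (TXalpha alpha)) (nat_plus m (class_product alpha)).
Proof.
move=> equiv hk eQ; have [refl [sym trans]] := equiv.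
have [C [r [CP CK rK]]] : exists (C : 'I_k -> X -> Prop) (r : (X -> Prop) -> 'I_k),
    [/\ forall i, classes alpha (C i), cancel C r & forall D, classes alpha D -> C (r D) = D].
  by apply: (has_card_ord _ hk); exists x0.
have /choice[a aP] i := CP i.
pose c x := r (alpha x).
have cP x : C (c x) = alpha x by apply: rK; exists x.
have aK : cancel a c by move=> i; rewrite /c -aP CK.
have cE x y : alpha x y <-> c x = c y.
  split=> [xy|cxy]; last by rewrite -cP cxy cP.
  by congr r; apply/funext => z; apply/propext; split; [apply: trans; exact: sym|exact: trans].
have aca x : alpha x (a (c x)) by apply/cE; rewrite aK.
have kerE : qkernel (TXalpha alpha) a c = class_product alpha.
  apply/funext => f; apply/propext; split=> -[].
    move=> Tf h; split=> // x; apply/cE; rewrite (Tf _ _ (aca x)).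
    by rewrite -[LHS](congr1 (@^~ (c x)) h).
  move=> af Tf; split=> //; apply/funext => i.
  by rewrite /qmap -(iffLR (cE _ _) (af _)) aK.
rewrite -kerE; apply: rank_idrank_nat_plus eQ => //.
- by move=> f g Tf _ x y xy; rewrite /comp_tr (Tf _ _ xy).
- by move=> s x y /cE xy; rewrite /qlift xy.
- by move=> f g i _ Tg; exact: Tg.
- rewrite kerE => p q [ap _] [_ Tq]; right; apply/funext => x.
  by apply: Tq; exact: sym.
- move=> f Ef; have Tf : TXalpha alpha f.
    by elim: Ef => [{}f []//|{}f g _ Tf _ _ x y xy]; rewrite /comp_tr (Tf _ _ xy).
  (* The last idempotent factor of [f] allows at most one image point per class. A choice function
     through these points, applied after the lift of the induced map, gives back [f]. *)
  have transversal x y : alpha (f x) (f y) -> f x = f y.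
    elim: Ef x y {Tf} => [{}f [Tf idf] x y fxy|{}f g _ _ _ IHg x y]; last exact: IHg.
    have idx z : f (f z) = f z := congr1 (@^~ z) idf.
    by rewrite -idx (Tf _ _ fxy) idx.
  have /choice[p pP] y : exists z, alpha y z /\ forall x, alpha y (f x) -> z = f x.
    have [[x yx]|nx] := pselect (exists x, alpha y (f x)).
      exists (f x); split=> // x' yx'; apply: transversal.
      by apply: trans yx'; exact: sym.
    by exists y; split=> // x yx; case: nx; exists x.
  exists (fun y => p (a (c y))).
    rewrite kerE; split=> [x|x y /cE -> //].
    by apply: trans (aca x) _; have [] := pP (a (c x)).
  right; apply/funext => x; rewrite /comp_tr /qlift /qmap aK.
  rewrite -(Tf _ _ (aca x)); have [_ /(_ x) -> //] := pP (a (c (f x))).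
  by apply: sym.
Qed.

(** A point [x] is recovered from its class and the choice function [p x], which picks [x] there and
    representatives elsewhere. Finitely many of both would make [X] finite. *)
Lemma class_product_infinite (X : Type) (x0 : X) (alpha : X -> X -> Prop) :
  is_equivalence alpha -> ~ finite_set (allX X) -> finite_set (classes alpha) ->
  ~ finite_set (class_product alpha).
Proof.
move=> equiv infX [k hk] [N hN]; apply: infX.
have [rep [arep repE]] := class_representatives x0 equiv.
have [refl [sym trans]] := equiv.
have cx z : classes alpha (alpha z) by exists z.
have [C [r [_ _ rK]]] := has_card_ord (cx x0) hk.
have repP : class_product alpha rep by split=> // x y /repE.
have [P [d [_ _ dK]]] := has_card_ord repP hN.
pose p x y := if `[< alpha y x >] then x else rep y.
have pP x : class_product alpha (p x).
  split=> [y|y z yz]; first by rewrite /p; case: asboolP.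
  rewrite /p (iffLR (repE _ _) yz); suff -> : alpha y x = alpha z x by [].
  by apply/propext; split; apply: trans => //; exact: sym.
apply: (@card_le_fin _ ('I_k * 'I_N)%type).
exists (fun x => (r (alpha x), d (p x))); split=> // x y _ _ [er ed].
have exy : p x = p y by rewrite -(dK _ (pP x)) ed dK.
have yx : alpha x y.
  by rewrite -(rK _ (cx x)) er rK.
have := congr1 (@^~ x) exy; rewrite /p asboolT // asboolT //.
Qed.

(** An infinite [P] absorbs a finite summand: both summands are coded by pairs in [P], tagged [io 0]
    and [io 1]. *)
Lemma card_eq_nat_plus_infinite (V : Type) (v0 : V) m n (P : V -> Prop) :
  ~ finite_set P -> card_eq (nat_plus m P) (nat_plus n P).
Proof.
move=> /card_le_nat_infinite infP; have [io [ioP ioI]] := infP.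
have PW := card_le_sig (ioP 0 I).
have [p pI] := card_le_square (card_le_trans infP PW).
have [f [_ fI]] := PW.
have svI : injective (@sval V P).
  by move=> [v Pv] [w Pw] /= evw; subst; rewrite (Prop_irrelevance Pv Pw).
have absorb m' n' : card_le (nat_plus m' P) (nat_plus n' P).
  exists (fun s => match s with
    | inl k => inr (sval (p (f (io 0)) (f (io k))))
    | inr v => inr (sval (p (f (io 1)) (f v))) end).
  split=> [[j|v] _ /=|[j|v] [j'|v'] /= h h' [] /svI/pI[e0 e]]; do ?exact: svalP.
  - by move/(fI _ _ (ioP _ I) (ioP _ I))/(ioI _ _ I I): e => ->.
  - by move/(fI _ _ (ioP _ I) (ioP _ I))/(ioI _ _ I I): e0.
  - by move/(fI _ _ (ioP _ I) (ioP _ I))/(ioI _ _ I I): e0.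
  - by rewrite (fI _ _ h h' e).
apply: card_le_anti => //; exact: (inr v0).
Qed.

(** * The ranks in all cases *)

Theorem theorem5p31 (X : Type) (x0 : X) :
  (* (i) *)
  (forall A : X -> Prop, (exists a, A a) ->
     (has_card A 1 ->
        rank_idrank_is (Eid (TXA A)) (fun k : nat => k < 1)) /\
     (~ finite_set (allX X) -> (exists a b, A a /\ A b /\ a <> b) ->
        rank_idrank_is (Eid (TXA A)) (fun _ : X -> bool => True)) /\
     (forall n, has_card (allX X) n -> has_card A 2 ->
        rank_idrank_is (Eid (TXA A)) (fun k : nat => k < 2 + 2 ^ (n - 2))) /\
     (forall n a, has_card (allX X) n -> has_card A a -> 3 <= a ->
        rank_idrank_is (Eid (TXA A)) (fun k : nat => k < 'C(a, 2) + a ^ (n - a)))) /\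
  (* (ii) *)
  (forall alpha : X -> X -> Prop, is_equivalence alpha ->
     (has_card (classes alpha) 1 ->
        rank_idrank_is (Eid (TXalpha alpha)) (allX X)) /\
     (~ finite_set (classes alpha) ->
        rank_idrank_is (Eid (TXalpha alpha))
          (cprod_set (class_powerset alpha) (class_product alpha))) /\
     (has_card (classes alpha) 2 -> finite_set (allX X) ->
        rank_idrank_is (Eid (TXalpha alpha)) (nat_plus 2 (class_product alpha))) /\
     (forall k, has_card (classes alpha) k -> 2 <= k -> ~ (k = 2 /\ finite_set (allX X)) ->
        rank_idrank_is (Eid (TXalpha alpha)) (nat_plus 'C(k, 2) (class_product alpha)))).
Proof.
have [e2 [Q2 eQ2]] := irredundant_family2.
split=> [A [x Ax]|alpha equiv].
  split=> [A1|].
    (* On one point the family is empty, as ['C(1, 2)] is 0; the only retraction is the constant map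
       onto [A]. *)
    have [e [Q eQ]] := @irredundant_family_bin2 1 isT.
    apply: (rank_idrank_card_eq (inr id) _ (rank_idrank_TXA Ax A1 eQ)).
    have [a [c [_ _ cK]]] := has_card_ord Ax A1.
    have A1' y : A y -> y = x.
      by move=> Ay; rewrite -(cK _ Ay) -(cK _ Ax) ord1 [c x]ord1.
    exists (fun=> 0); split=> //; split=> [[//|f] [//|g] /= [Tf _] [Tg _] _|[|//] _].
      by congr inr; apply/funext => y; rewrite (A1' _ (Tf y)) (A1' _ (Tg y)).
    by exists (inr (fun=> x)) => //=; split=> // y /A1'.
  split=> [infX [a [b [Aa [Ab ab]]]]|]; first exact: (rank_idrank_TXA_infinite infX Aa Ab ab).
  split=> [n Xn A2|n a Xn Aa a3].
    apply: (rank_idrank_card_eq (inr id) _ (rank_idrank_TXA Ax A2 eQ2)).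
    exact/has_card_nat_plus/(has_card_retraction Ax).
  have [|e [Q eQ]] := @irredundant_family_bin2 a; first by case: a a3 {Aa} => [|[|[|]]].
  apply: (rank_idrank_card_eq (inr id) _ (rank_idrank_TXA Ax Aa eQ)).
  exact/has_card_nat_plus/(has_card_retraction Ax).
have [refl _] := equiv.
split=> [C1|].
  have [e [Q eQ]] := @irredundant_family_bin2 1 isT.
  apply: (rank_idrank_card_eq (inr id) _ (rank_idrank_TXalpha x0 equiv C1 eQ)).
  have cx w : classes alpha (alpha w) by exists w.
  have [C [r [_ _ rK]]] := has_card_ord (cx x0) C1.
  have all1 y z : alpha y z.
    by rewrite -(rK _ (cx y)) ord1 -[ord0](ord1 (r (alpha z))) rK.
  (* With a single class the choice functions are the constants, one for each point of [X]. *)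
  exists (fun s => if s is inr f then f x0 else x0); split=> //; split.
    move=> [//|f] [//|g] /= [_ Tf] [_ Tg] e0; congr inr; apply/funext => y.
    by rewrite (Tf y x0) // (Tg y x0).
  by move=> y _; exists (inr (fun=> y)).
split; first exact: (rank_idrank_TXalpha_infinite x0 equiv).
split=> [C2 _|k Ck k2 nk]; first exact: (rank_idrank_TXalpha x0 equiv C2 eQ2).
have [ek|nk2] := eqVneq k 2; last first.
  have [e [Q eQ]] := irredundant_family_bin2 nk2.
  exact: (rank_idrank_TXalpha x0 equiv Ck eQ).
(* With two classes the family has 2 members while ['C(2, 2)] is 1; [X] being infinite, the infinite
   product absorbs the difference. *)
subst k; apply: (rank_idrank_card_eq (inr id) _ (rank_idrank_TXalpha x0 equiv Ck eQ2)).
apply: (card_eq_nat_plus_infinite id); apply: class_product_infinite => //.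
  by move=> finX; apply: nk.
by exists 2.
Qed.
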